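(* Assume that there exists a Markov process $(\mathbb{Q}_x)_{x\in E}$ with state space $E$ such that, for all $t>0$, $$\lim_{T\to+\infty}\ \sup_{x\in E}\left\|\mathbb{Q}_x(X_t\in\cdot)-\mathbb{P}_x(X_t\in\cdot\mid T<\tau_\partial)\right\|_{TV}=0$$ and such that $$\lim_{t\to+\infty}\ \sup_{x,y\in E}\left\|\mathbb{Q}_x(X_t\in\cdot)-\mathbb{Q}_y(X_t\in\cdot)\right\|_{TV}=0.$$ Then the process $(\mathbb{P}_x)_{x\in E}$ admits a unique quasi-stationary distribution $\alpha$, and there exist positive constants $\gamma,C$ such that $$\left\|\mathbb{P}_\mu(X_t\in\cdot\mid t<\tau_\partial)-\alpha\right\|_{TV}\leq C e^{-\gamma t},\qquad\forall \mu\in\mathcal{P}(E),\ \forall t\geq 0.$$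
   Context: Setting. $(\Omega,(\mathcal{F}_t)_{t\geq 0},(X_t)_{t\geq 0},(\mathbb{P}_x)_{x\in E\cup\{\partial\}})$ is a time-homogeneous Markov process with state space $E\cup\{\partial\}$, where $E$ is a measurable space and $\partial\notin E$. The point $\partial$ is absorbing: $X_s=\partial$ implies $X_t=\partial$ for all $t\geq s$, $\mathbb{P}_x$-almost surely for all $x\in E$. Set $\tau_\partial:=\inf\{t\geq 0: X_t=\partial\}$, which is a stopping time. It is assumed that $\mathbb{P}_x(\tau_\partial<\infty)=1$ and $\mathbb{P}_x(t<\tau_\partial)>0$ for all $t\geq 0$ and all $x\in E$. $\mathcal{P}(E)$ is the set of probability measures on $E$; for $\mu\in\mathcal{P}(E)$, $\mathbb{P}_\mu=\int_E\mathbb{P}_x\,\mu(dx)$ is the law of the process with initial distribution $\mu$. $\|\cdot\|_{TV}$ is the total variation norm. A Markov process $(\mathbb{Q}_x)_{x\in E}$ with state space $E$ is given by its laws, $\mathbb{Q}_x$ being the law when started from $x\in E$; $\mathbb{Q}_x(X_t\in\cdot)$ is the law on $E$ of its position at time $t$. A probability measure $\alpha$ on $E$ is called a quasi-stationary distribution of the process $(\mathbb{P}_x)_{x\in E}$ if $\mathbb{P}_\alpha(X_t\in\cdot\mid t<\tau_\partial)=\alpha$ for all $t\geq 0$. *)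

(* Defs.v *)
From HB Require Import structures.
From mathcomp Require Import all_boot all_order all_algebra.
From mathcomp Require Import all_classical all_reals all_analysis.
(* [all_analysis] does not export the measurable structures of R and \bar R *)
From mathcomp Require Import measurable_realfun.

Set Implicit Arguments.
Unset Strict Implicit.
Unset Printing Implicit Defensive.

Import Order.TTheory GRing.Theory Num.Theory.
Import numFieldNormedType.Exports.

Local Open Scope classical_set_scope.
Local Open Scope ring_scope.

(** [option E] is E together with one extra point, the cemetery [None]. A set
    is measurable when its trace on E is, so that [None] is a measurable
    singleton. *)

Definition option_display (d : measure_display) : measure_display.
Proof. exact: default_measure_display. Qed.

Section option_measurable.
Context (d : measure_display) (E : measurableType d).

Definition option_measurable : set (set (option E)) :=
  image_set_system setT Some (@measurable d E).

Let sigma_algebra_option : sigma_algebra setT option_measurable.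
Proof. exact/sigma_algebra_image/sigma_algebra_measurable. Qed.

Let option_measurable0 : option_measurable set0.
Proof. by case: sigma_algebra_option. Qed.

Let option_measurableC (A : set (option E)) :
  option_measurable A -> option_measurable (~` A).
Proof. by case: sigma_algebra_option => _ + _ => /[apply]; rewrite setTD. Qed.

Let option_measurable_bigcup (F : (set (option E))^nat) :
  (forall i, option_measurable (F i)) -> option_measurable (\bigcup_i F i).
Proof. by case: sigma_algebra_option => _ _; apply. Qed.

HB.instance Definition _ := @isMeasurable.Build (option_display d) (option E)
  option_measurable option_measurable0 option_measurableC
  option_measurable_bigcup.

Lemma measurable_image_Some (A : set E) :
  measurable A -> measurable (Some @` A : set (option E)).
Proof.
move=> mA; rewrite /measurable/= /option_measurable /image_set_system/= setTI.
rewrite [X in measurable X](_ : _ = A)//.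
by apply/seteqP; split=> [x [y Ay [<-]]//|x Ax]; exists x.
Qed.

Lemma measurable_Some : measurable_fun [set: E] (Some : E -> option E).
Proof. by move=> _ B mB. Qed.

End option_measurable.

(** Total variation norm: the total mass [nu^+ + nu^-] of the variation of a
    charge (it does not depend on the Hahn decomposition). With this
    normalisation two mutually singular probability measures are at distance
    2. *)

Section total_variation_norm.
Context (d : measure_display) (T : measurableType d) (R : realType).

Definition tv_norm (nu : {charge set T -> \bar R}) : \bar R :=
  let PNnu := cid (Hahn_decomposition nu) in
  charge_variation (projT2 (cid (projT2 PNnu))) [set: T].

Definition tv_dist (mu nu : {finite_measure set T -> \bar R}) : \bar R :=
  tv_norm (cadd (charge_of_finite_measure mu)
                (copp (charge_of_finite_measure nu))).

End total_variation_norm.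

(** Time-homogeneous Markov process with state space S, realised on Om. Times
    range over R; [mp_filtration t] and [mp_pos t] are irrelevant for [t < 0].
    Singletons of S need not be measurable, so [X_0 = x] a.s. is stated as the law of [X_0]
    being the Dirac mass at [x]. *)

Record markov_process (R : realType) (d : measure_display)
    (S : measurableType d) (d' : measure_display) (Om : measurableType d') := {
  mp_filtration : R -> set (set Om) ;
  mp_pos : R -> {mfun Om >-> S} ;
  mp_law : S -> probability Om R ;
  mp_filtration_sigma_algebra : forall t : R, 0 <= t ->
    sigma_algebra setT (mp_filtration t) ;
  mp_filtration_measurable : forall t : R, 0 <= t ->
    mp_filtration t `<=` measurable ;
  mp_filtration_nondecreasing : forall s t : R, 0 <= s -> s <= t ->
    mp_filtration s `<=` mp_filtration t ;
  mp_adapted : forall (t : R) (A : set S), 0 <= t -> measurable A ->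
    mp_filtration t (mp_pos t @^-1` A) ;
  mp_law_measurable : forall B : set Om, measurable B ->
    measurable_fun [set: S] (fun x => mp_law x B) ;
  mp_law_initial : forall x (A : set S), measurable A ->
    mp_law x (mp_pos 0 @^-1` A) = \d_x A ;
  (* P_x(X_{s+t} \in A | F_s) = P_{X_s}(X_t \in A), P_x-a.s. *)
  mp_markov : forall x (s t : R) (A : set S) (B : set Om), 0 <= s -> 0 <= t ->
    measurable A -> mp_filtration s B ->
    mp_law x (B `&` mp_pos (s + t) @^-1` A) =
      (\int[mp_law x]_(w in B) mp_law (mp_pos s w) (mp_pos t @^-1` A))%E
}.

Definition tau (R : realType) (d : measure_display) (E : measurableType d)
    (d' : measure_display) (Om : measurableType d')
    (X : markov_process R (option E) Om) (w : Om) : \bar R :=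
  ereal_inf [set t%:E | t in [set t : R | 0 <= t /\ mp_pos X t w = None]].

Record absorbed_markov_process (R : realType) (d : measure_display)
    (E : measurableType d) (d' : measure_display) (Om : measurableType d') := {
  amp_process :> markov_process R (option E) Om ;
  amp_absorbing : forall x : E, {ae mp_law amp_process (Some x), forall w,
    forall s t : R, 0 <= s -> s <= t ->
      mp_pos amp_process s w = None -> mp_pos amp_process t w = None} ;
  amp_stopping_time : forall t : R, 0 <= t ->
    mp_filtration amp_process t [set w | (tau amp_process w <= t%:E)%E] ;
  amp_tau_finite : forall x : E,
    mp_law amp_process (Some x) [set w | (tau amp_process w < +oo)%E] = 1%E ;
  amp_survival : forall (x : E) (t : R), 0 <= t ->
    (0 < mp_law amp_process (Some x) [set w | (t%:E < tau amp_process w)%E])%E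
}.

Section conditional_laws.
Context (R : realType) (d : measure_display) (E : measurableType d)
  (d' : measure_display) (Om : measurableType d').
Variable X : absorbed_markov_process R E Om.

Definition survival (T : R) : set Om := [set w | (T%:E < tau X w)%E].

Lemma measurable_survival (T : R) : measurable (survival T).
Proof.
have [T0|T0] := leP 0 T.
  rewrite (_ : survival T = ~` [set w | (tau X w <= T%:E)%E]).
    apply: measurableC; apply: (mp_filtration_measurable (m := X) T0).
    exact: amp_stopping_time.
  by apply/seteqP; split=> w; rewrite /survival/= ltNge => /negP.
rewrite (_ : survival T = setT)//; apply/seteqP; split=> // w _.
rewrite /survival/= (@lt_le_trans _ _ 0%E)//.
by apply: le_ereal_inf_tmp => _ [t [t0 _] <-]; rewrite lee_fin.
Qed.

(** P_mu, for mu a probability measure on E *)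
Definition law_from (mu : probability E R) (B : set Om) : \bar R :=
  (\int[mu]_x mp_law X (Some x) B)%E.

Section law_from_probability.
Variable mu : probability E R.

Let law_from0 : law_from mu set0 = 0%E.
Proof.
by rewrite /law_from; under eq_integral do rewrite measure0; rewrite integral0.
Qed.

Let law_from_ge0 B : (0 <= law_from mu B)%E.
Proof. by apply: integral_ge0. Qed.

Let measurable_law B : measurable B ->
  measurable_fun [set: E] (fun x => mp_law X (Some x) B).
Proof.
move=> mB; apply: (measurableT_comp (mp_law_measurable X mB)).
exact: measurable_Some.
Qed.

Let law_from_sigma_additive : semi_sigma_additive (law_from mu).
Proof.
move=> F mF tF mUF.
have -> : law_from mu (\bigcup_n F n) =
    (\sum_(0 <= n <oo) law_from mu (F n))%E.
  rewrite /law_from -integral_nneseries//; last first.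
    by move=> n; exact: measurable_law.
  apply: eq_integral => x _; apply/esym/cvg_lim => //.
  exact: measure_semi_sigma_additive.
by apply: is_cvg_nneseries => n _ _; exact: law_from_ge0.
Qed.

HB.instance Definition _ := isMeasure.Build _ _ _ (law_from mu)
  law_from0 law_from_ge0 law_from_sigma_additive.

Let law_from_setT : law_from mu [set: Om] = 1%E.
Proof.
rewrite /law_from; under eq_integral do rewrite probability_setT.
by rewrite integral_cst// mul1e; exact: probability_setT.
Qed.

HB.instance Definition _ :=
  Measure_isProbability.Build _ _ _ (law_from mu) law_from_setT.

End law_from_probability.

(** The law P(X_t \in . | T < tau) on E; it is used for [t <= T], in which case
    X_t lies in E on the event [T < tau]. *)
Definition cond_law (P : probability Om R) (t T : R) (A : set E) : \bar R :=
  (P ((mp_pos X t @^-1` (Some @` A)) `&` survival T)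
     * (fine (P (survival T)))^-1%:E)%E.

Section cond_law_measure.
Variables (P : probability Om R) (t T : R).

Let mpre (A : set E) : measurable A ->
  measurable ((mp_pos X t @^-1` (Some @` A)) `&` survival T).
Proof.
move=> mA; apply: measurableI; last exact: measurable_survival.
by rewrite -[X in measurable X]setTI; apply: measurable_funP => //;
  exact: measurable_image_Some.
Qed.

Let cond_law0 : cond_law P t T set0 = 0%E.
Proof. by rewrite /cond_law image_set0 preimage_set0 set0I measure0 mul0e. Qed.

Let cond_law_ge0 A : (0 <= cond_law P t T A)%E.
Proof. by rewrite mule_ge0// lee_fin invr_ge0 fine_ge0. Qed.

Let cond_law_sigma_additive : semi_sigma_additive (cond_law P t T).
Proof.
move=> F mF tF mUF; rewrite /cond_law.
rewrite [X in X @ _ --> _](_ : _ = (fun n => \sum_(0 <= i < n)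
    P ((mp_pos X t @^-1` (Some @` F i)) `&` survival T))%E
    \* cst (fine (P (survival T)))^-1%:E)%E; last first.
  by apply/funext => n; rewrite /= -ge0_sume_distrl.
apply: cvgeZr => //.
rewrite image_bigcup preimage_bigcup setI_bigcupl.
apply: measure_semi_sigma_additive => [i||].
- exact: mpre.
- apply/trivIsetP => i j _ _ ij; rewrite -subset0 => w [[[x Fx xw] _]].
  move=> [[y Fy yw] _]; move: xw; rewrite -yw => -[xy].
  move/trivIsetP : tF => /(_ i j Logic.I Logic.I ij); rewrite -subset0.
  by apply; split; [exact: Fx|rewrite xy].
- by apply: bigcup_measurable => i _; exact: mpre.
Qed.

HB.instance Definition _ := isMeasure.Build _ _ _ (cond_law P t T)
  cond_law0 cond_law_ge0 cond_law_sigma_additive.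

Let cond_law_fin : fin_num_fun (cond_law P t T).
Proof.
by move=> A mA; rewrite fin_numM// fin_num_measure//; exact: mpre.
Qed.

HB.instance Definition _ := Measure_isFinite.Build _ _ _ (cond_law P t T)
  cond_law_fin.

End cond_law_measure.

Definition quasi_stationary (alpha : probability E R) : Prop :=
  forall t : R, 0 <= t -> forall A : set E, measurable A ->
    cond_law (law_from alpha) t t A = alpha A.

End conditional_laws.

(* Main.v *)
Require Import Defs.
From HB Require Import structures.
From mathcomp Require Import all_boot all_order all_algebra.
From mathcomp Require Import all_classical all_reals all_analysis.
From mathcomp Require Import measurable_realfun giry.
From mathcomp Require Import ring lra.

Set Implicit Arguments.
Unset Strict Implicit.
Unset Printing Implicit Defensive.

Import Order.TTheory GRing.Theory Num.Theory.
Import numFieldNormedType.Exports.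

Local Open Scope classical_set_scope.
Local Open Scope ring_scope.

(** Write [S t x A] for the probability that the process started from [x] is in
    [A] at time [t]; this is a sub-Markov semigroup on [E], and everything about
    the conditional laws can be read off from it. The law of the position at
    time [u] given survival until [u + v] is the kernel
    [K u v x (dy) = S u x (dy) S v y E / S (u + v) x E] ([conditioned]). By the
    Markov property, conditioning on survival until a fixed horizon gives a
    time-inhomogeneous Markov chain ([conditioned_add]):
    [K (u + u') v = K u (u' + v) K u' v].

    The two hypotheses on the auxiliary process [Q] say that for some time [u0]
    and every late enough horizon, [K u0 v x] is close to [Q_x(X_u0 \in .)],
    which hardly depends on [x]. Hence the laws [K u0 v x] differ by at most 1/2
    on every event, uniformly in [x] and in [v >= v0]. By Dobrushin's argument
    ([integral_le_osc], [osc_le_mul]) each step of length [u0] in the chain then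
    halves the dependence on the starting point, as long as the remaining time
    to the horizon is at least [v0]. With horizon [t] there are about
    [(t - v0) / u0] such steps, so [K t 0 x] depends on [x] by at most
    [C exp(- gamma t)] ([osc_le_exp]).

    The law at time [t] given survival until [t] and started from [mu]
    ([conditional_flow]) is an average of the [K t 0 x], so that two initial
    laws give conditional laws within [C exp(- gamma t)] of one another
    ([conditional_flow_le]). As conditioning is a semiflow on probability
    measures ([conditional_flow_add]), its orbits are Cauchy uniformly over
    events; the limit of one orbit is a fixed point
    ([stationary_conditional_flow]), that is, a quasi-stationary distribution.
    Uniqueness and the rate of convergence follow by comparing any orbit with
    that fixed point.

    The link with the process requires that survival beyond [t] be almost surely
    the event [X_t \in E]. Without right continuity of paths the process could
    be in [E] at time [t] and die immediately afterwards; that this has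
    probability zero comes from the stopping time property of the lifetime
    ([alive_not_surviving_negligible]). *)

(** * Total variation and values on events *)

Section total_variation.
Context (d : measure_display) (T : measurableType d) (R : realType).
Local Open Scope ereal_scope.

Let tv_normE (nu : {charge set T -> \bar R}) :
  exists P N (PN : hahn_decomposition nu P N),
    tv_norm nu = charge_variation PN [set: T].
Proof. by do 3 eexists; reflexivity. Qed.

Lemma abse_le_tv_norm (nu : {charge set T -> \bar R}) (A : set T) :
  measurable A -> `|nu A| <= tv_norm nu.
Proof.
move=> mA; have [P [N [PN ->]]] := tv_normE nu.
apply: (le_trans (abse_charge_variation PN mA)).
apply: leeD.
  by apply: (@le_measure _ _ _ (jordan_pos PN)) => //; rewrite inE.
by apply: (@le_measure _ _ _ (jordan_neg PN)) => //; rewrite inE.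
Qed.

Lemma tv_norm_le (nu : {charge set T -> \bar R}) (c : \bar R) :
  (forall A, measurable A -> `|nu A| <= c) -> tv_norm nu <= c + c.
Proof.
move=> nuc; have [P [N [PN ->]]] := tv_normE nu.
have [[mP _] [mN _] _ _] := PN.
rewrite /charge_variation; apply: leeD.
  rewrite jordan_posE cjordan_posE /crestr0 mem_set// /crestr setTI.
  exact: (le_trans (lee_abs _) (nuc _ mP)).
rewrite jordan_negE cjordan_negE /crestr0 mem_set// /crestr setTI.
by rewrite (le_trans (lee_abs _))// abseN; exact: nuc.
Qed.

Variables m1 m2 : {finite_measure set T -> \bar R}.

Lemma le_add_tv_dist (A : set T) : measurable A ->
  m1 A <= m2 A + tv_dist m1 m2.
Proof.
move=> mA; rewrite -leeBlDl ?fin_num_measure//.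
apply: le_trans (abse_le_tv_norm _ mA).
exact: lee_abs.
Qed.

Lemma le_add_tv_distr (A : set T) : measurable A ->
  m2 A <= m1 A + tv_dist m1 m2.
Proof.
move=> mA; rewrite -leeBlDl ?fin_num_measure//.
apply: le_trans (abse_le_tv_norm _ mA).
change (m2 A - m1 A <= `|m1 A - m2 A|).
by rewrite -[m1 A - m2 A]oppeK abseN fin_num_oppeB ?fin_num_measure// addeC lee_abs.
Qed.

Lemma tv_dist_le (c : R) :
  (forall A, measurable A -> m1 A <= m2 A + c%:E) ->
  (forall A, measurable A -> m2 A <= m1 A + c%:E) ->
  tv_dist m1 m2 <= (c + c)%:E.
Proof.
move=> m12 m21; rewrite EFinD; apply: tv_norm_le => A mA.
change (`|m1 A - m2 A| <= c%:E).
move: (fin_num_measure m1 A mA) (fin_num_measure m2 A mA) (m12 A mA) (m21 A mA).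
move=> /EFin_fin_numP[a ->] /EFin_fin_numP[b ->].
rewrite -!EFinD !lee_fin => ab ba.
by rewrite ler_norml; apply/andP; split; lra.
Qed.

End total_variation.

(** * Dobrushin's inequality *)

Section dobrushin.
Context (d : measure_display) (T : measurableType d) (R : realType).
Local Open Scope ereal_scope.

(** Only the oscillation of [f] matters, so [f] may be shifted to take its values
    in [[0, eps]]; its integral is then the integral over [[0, eps]] of its tail
    probabilities, each of which changes by at most [del] from [mu] to [nu]. The
    product [del * eps] is what makes this a contraction estimate. *)
Lemma integral_le_osc (mu nu : probability T R) (f : T -> R) (del eps : R) :
  (0 <= del)%R ->
  measurable_fun setT f -> (forall x y, (f x <= f y + eps)%R) ->
  (forall A, measurable A -> mu A <= nu A + del%:E) ->
  \int[mu]_x (f x)%:E <= \int[nu]_x (f x)%:E + (del * eps)%:E.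
Proof.
move=> del0 mf osc munu.
have eps0 : (0 <= eps)%R by have := osc point point; lra.
pose a := inf (range f).
have af x : (a <= f x)%R.
  apply: ge_inf; last by exists x.
  by exists (f point - eps)%R => _ [y _ <-]; have := osc point y; lra.
have fa x : (f x <= a + eps)%R.
  rewrite -lerBlDr; apply: lb_le_inf; first by exists (f x); exists x.
  by move=> _ [y _ <-]; have := osc x y; lra.
pose h x := (f x - a)%R.
have mh : measurable_fun setT h by exact: measurable_funB.
have h0 x : (0 <= h x)%R by rewrite subr_ge0.
pose H : {mfun T >-> R} := HB.pack h (isMeasurableFun.Build _ _ _ _ h mh).
have intE (P : probability T R) :
    \int[P]_x (f x)%:E = 'E_P[H] + a%:E.
  rewrite expectation_def.
  transitivity (\int[P]_x ((h x)%:E + (cst a%:E x))).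
    by apply: eq_integral => x _; rewrite /h /= -EFinD subrK.
  rewrite integralD//; last 2 first.
  - have -> : (fun x => (h x)%:E) = EFin \o h by [].
    apply: measurable_bounded_integrable => //.
      by rewrite -ge0_fin_numE// fin_num_measure.
    exists `|eps|%R; split; first exact: num_real.
    move=> M epsM x _ /=; rewrite ger0_norm//.
    apply: (le_trans _ (ltW epsM)); apply: (le_trans _ (ler_norm _)).
    by rewrite /h; have := fa x; lra.
  - exact: finite_measure_integrable_cst.
  by rewrite integral_cst// [X in _ * X]probability_setT mule1.
rewrite !intE addeAC leeD2r// !ge0_expectation_ccdf//.
(* the tails of [h] vanish beyond [eps], and below it differ by at most [del] *)
have -> : (del * eps)%:E = \int[@lebesgue_measure R]_(r in `[0%R, +oo[)
   (del%:E * (\1_(`[0%R, eps]) r)%:E).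
  rewrite ge0_integralZl//; last first.
    exact/measurable_funTS/measurable_EFinP/measurable_indic.
  rewrite integral_indic// setIidl; last first.
    by move=> r /=; rewrite !in_itv/= andbT => /andP[].
  rewrite [X in _ * X](_ : _ =
      if 0%:E < eps%:E then eps%:E - 0%:E else 0); last first.
    exact: (@lebesgue_measure_itv R `[0%R, eps]).
  rewrite lte_fin.
  by case: ltgtP eps0 => // [_|<-] _; rewrite ?EFinM ?sube0// mule0 mulr0.
rewrite -ge0_integralD//; last 3 first.
- by apply: measurable_funTS; exact: ccdf_measurable.
- by move=> x _; rewrite mule_ge0// lee_fin.
- apply: measurable_funeM; exact/measurable_funTS/measurable_EFinP/measurable_indic.
apply: ge0_le_integral => //.
- by apply: measurable_funTS; exact: ccdf_measurable.
- apply: emeasurable_funD; first by apply: measurable_funTS; exact: ccdf_measurable.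
  apply: measurable_funeM; exact/measurable_funTS/measurable_EFinP/measurable_indic.
move=> r; rewrite /= in_itv/= andbT => r0; rewrite indicE.
have mA : measurable (H @^-1` `]r, +oo[).
  by apply: (measurable_funPTI H); exact: measurable_itv.
have [re|re] := boolP (r \in `[0%R, eps]).
  by rewrite mem_set// mule1; exact: munu.
rewrite memNset; last by apply/negP.
rewrite mule0 adde0 /ccdf /distribution /pushforward.
suff -> : H @^-1` `]r, +oo[ = set0 by rewrite !measure0.
apply/seteqP; split => // x /=; rewrite in_itv/= andbT => rx.
move: re; rewrite in_itv/= r0/= -ltNge.
by have := fa x; move: rx; rewrite /H/= /h; lra.
Qed.

End dobrushin.

(** * Limits of uniformly Cauchy sequences of probability measures *)

Section setwise_limit.
Context (d : measure_display) (T : measurableType d) (R : realType).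
Variables (mu : nat -> probability T R) (eps : nat -> R).
Hypothesis eps_cvg0 : eps @ \oo --> (0 : R).
Hypothesis mu_cauchy : forall n m (A : set T), (n <= m)%N -> measurable A ->
  `|fine (mu m A) - fine (mu n A)| <= eps n.

(* the absolute value keeps [limA] nonnegative on nonmeasurable sets, where
   the limit need not exist *)
Let limA (A : set T) : R := `|lim (fine (mu n A) @[n --> \oo])|.

Let cvg_mu (A : set T) : measurable A -> cvg (fine (mu n A) @[n --> \oo]).
Proof.
move=> mA; apply/cauchy_cvgP/cauchy_exP => e e0.
have /cvgrPdist_lt/(_ _ e0)[N _ epsN] := eps_cvg0.
exists (fine (mu N A)); exists N => // m /= Nm.
rewrite /ball/= distrC (le_lt_trans (mu_cauchy Nm mA))//.
have := epsN _ (leqnn N); rewrite /= sub0r normrN; apply: le_lt_trans.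
exact: ler_norm.
Qed.

Let limE (A : set T) : measurable A -> fine (mu n A) @[n --> \oo] --> limA A.
Proof.
move=> mA; rewrite /limA ger0_norm; first exact: cvg_mu.
by apply: limr_ge; [exact: cvg_mu|near=> n; exact: fine_ge0].
Unshelve. all: by end_near. Qed.

Let limA_dist n (A : set T) : measurable A ->
  `|limA A - fine (mu n A)| <= eps n.
Proof.
move=> mA; have h : `|fine (mu m A) - fine (mu n A)| @[m --> \oo] -->
    `|limA A - fine (mu n A)|.
  by apply: cvg_norm; apply: cvgB; [exact: limE|exact: cvg_cst].
rewrite -(cvg_lim _ h)//; apply: limr_le; first by apply/cvg_ex; eexists; exact: h.
by near=> m; apply: mu_cauchy => //; near: m; exact: nbhs_infty_ge.
Unshelve. all: by end_near. Qed.

Let limAU (A B : set T) : measurable A -> measurable B -> A `&` B = set0 ->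
  limA (A `|` B) = limA A + limA B.
Proof.
move=> mA mB AB0; have mAB : measurable (A `|` B) by exact: measurableU.
rewrite -(cvg_lim _ (limE mAB))//; apply/cvg_lim => //.
under eq_fun do rewrite measureU// fineD ?fin_num_measure//.
by apply: cvgD; exact: limE.
Qed.

Let limA0 : limA set0 = 0.
Proof.
rewrite /limA; under eq_fun do rewrite measure0 /=.
by rewrite lim_cst// normr0.
Qed.

Let alpha (A : set T) : \bar R := (limA A)%:E.

Let alpha0 : alpha set0 = 0%E.
Proof. by rewrite /alpha limA0. Qed.

Let alpha_ge0 A : (0 <= alpha A)%E.
Proof. by rewrite lee_fin /limA. Qed.

(* Uniformity in the event is essential here: a single [mu N] approximates the
   limit both on the finite unions and on the countable one, and for [mu N] the
   former converge to the latter. *)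
Let alpha_sigma_additive : semi_sigma_additive alpha.
Proof.
move=> F mF tF mUF.
have sumE n : (\sum_(0 <= i < n) alpha (F i))%E =
    (limA (\big[setU/set0]_(i < n) F i))%:E.
  rewrite big_mkord.
  elim: n => [|n ih]; first by rewrite !big_ord0 limA0.
  rewrite !big_ord_recr /= ih limAU ?EFinD//.
    by apply: bigsetU_measurable => *; exact: mF.
  apply: (@trivIset_bigsetUI _ xpredT F) => //.
  by apply: sub_trivIset tF.
under eq_fun do rewrite sumE.
apply: cvg_EFin; first exact: nearW.
apply/cvgrPdist_le => e e0.
have e40 : 0 < e / 4 by lra.
have /cvgrPdist_lt/(_ _ e40)[N _ epsN] := eps_cvg0.
have epsN4 : eps N < e / 4.
  have := epsN _ (leqnn N); rewrite /= sub0r normrN; apply: le_lt_trans.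
  exact: ler_norm.
have : fine (mu N (\big[setU/set0]_(i < n) F i)) @[n --> \oo] -->
    fine (mu N (\bigcup_n F n)).
  have UE : \bigcup_n F n = \bigcup_n \big[setU/set0]_(i < n) F i.
    apply/seteqP; split; last by apply: bigcup_sub => n _; exact: bigsetU_bigcup.
    by rewrite -bigcup_bigsetU_bigcup => x [n _ Fx]; exists n.+1.
  apply: fine_cvg; rewrite fineK ?fin_num_measure// UE.
  apply: nondecreasing_cvg_mu => //.
  - by move=> n; exact: bigsetU_measurable.
  - by rewrite -UE.
  - by move=> n m nm; apply/subsetPset; exact: subset_bigsetU.
move=> /cvgrPdist_le/(_ _ e40); apply: filterS => n /= hn.
have mUn : measurable (\big[setU/set0]_(i < n) F i) by exact: bigsetU_measurable.
have := limA_dist N mUF; have := limA_dist N mUn.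
move: hn; rewrite !ler_norml => /andP[? ?] /andP[? ?] /andP[? ?].
by apply/andP; split; lra.
Unshelve. all: by end_near. Qed.

HB.instance Definition _ := isMeasure.Build _ _ _ alpha
  alpha0 alpha_ge0 alpha_sigma_additive.

Let alpha_setT : alpha [set: T] = 1%E.
Proof.
congr EFin; rewrite -(cvg_lim _ (limE measurableT))//; apply/cvg_lim => //.
by under eq_fun do rewrite probability_setT/=; exact: cvg_cst.
Qed.

HB.instance Definition _ :=
  Measure_isProbability.Build _ _ _ alpha alpha_setT.

Lemma setwise_limit : exists al : probability T R, forall n (A : set T),
  measurable A -> `|fine (al A) - fine (mu n A)| <= eps n.
Proof. by exists alpha => n A mA; exact: limA_dist. Qed.

End setwise_limit.

(** * Normalised measures and mixtures *)

Section normalization.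
Context (d : measure_display) (T : measurableType d) (R : realType).
Local Open Scope ereal_scope.

(** The Dirac mass is a default value for the zero measure; all the measures
    normalised below have positive mass. *)
Definition normalized (m : giry T R) : probability T R :=
  mnormalize m (\d_point : probability T R).

Variable m : giry T R.
Hypothesis m_gt0 : 0 < m [set: T].

Lemma fine_mass_gt0 : (0 < fine (m [set: T]))%R.
Proof. by rewrite fine_gt0// m_gt0 ltey_eq fin_num_measure. Qed.

Lemma normalizedE (A : set T) :
  normalized m A = (fine (m [set: T]))^-1%:E * m A.
Proof.
rewrite /normalized /= /mnormalize gt_eqF//= lt_eqF; last first.
  by rewrite ltey_eq fin_num_measure.
by rewrite muleC.
Qed.

Lemma integral_normalized (f : T -> \bar R) :
  (forall x, 0 <= f x) -> measurable_fun setT f ->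
  \int[normalized m]_x f x = (fine (m [set: T]))^-1%:E * \int[m]_x f x.
Proof.
move=> f0 mf.
have c0 : (0 <= (fine (m [set: T]))^-1)%R.
  by rewrite invr_ge0 ltW// fine_mass_gt0.
rewrite (eq_measure_integral (mscale (NngNum c0) m)); last first.
  by move=> A mA _; exact: normalizedE.
by rewrite ge0_integral_mscale.
Qed.

Lemma mass_normalized (A : set T) :
  m [set: T] * normalized m A = m A.
Proof.
rewrite normalizedE -{1}[m setT]fineK ?fin_num_measure// muleA -EFinM.
by rewrite divff ?mul1e// gt_eqF// fine_mass_gt0.
Qed.

Lemma mass_integral_normalized (f : T -> \bar R) :
  (forall x, 0 <= f x) -> measurable_fun setT f ->
  m [set: T] * \int[normalized m]_x f x = \int[m]_x f x.
Proof.
move=> f0 mf; rewrite integral_normalized//.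
rewrite -{1}[m setT]fineK ?fin_num_measure// muleA -EFinM.
by rewrite divff ?mul1e// gt_eqF// fine_mass_gt0.
Qed.

End normalization.

Lemma mule_cancel (R : realType) (a b c : \bar R) :
  a \is a fin_num -> (0 < a)%E -> (a * b = a * c)%E -> b = c.
Proof.
move=> afin a0 abc; apply/eqP; rewrite eq_le.
by rewrite -(lee_pmul2l afin a0) -[X in _ && X](lee_pmul2l afin a0) abc lexx.
Qed.

Lemma integral_eq0_measure0 (d : measure_display) (T : measurableType d)
    (R : realType) (mu : {measure set T -> \bar R}) (D : set T)
    (f : T -> \bar R) :
  measurable D -> measurable_fun D f -> (forall x, D x -> (0 < f x)%E) ->
  (\int[mu]_(x in D) f x = 0)%E -> mu D = 0%E.
Proof.
move=> mD mf f0 int0.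
have /(ae_eq_integral_abs mu mD mf) : (\int[mu]_(x in D) `|f x| = 0)%E.
  by rewrite -int0; apply: eq_integral => x /[!inE] Dx; rewrite gte0_abs ?f0.
case=> N [mN N0 subN]; apply/eqP; rewrite eq_le measure_ge0 andbT -N0.
apply: le_measure; rewrite ?inE// => x Dx; apply: subN => /= /(_ Dx) fx0.
by have := f0 x Dx; rewrite fx0 ltxx.
Qed.

Lemma measurable_inv_fine (d : measure_display) (T : measurableType d)
    (R : realType) (f : T -> \bar R) :
  (forall x, (0 <= f x)%E) -> measurable_fun setT f ->
  measurable_fun setT (fun x => (fine (f x))^-1).
Proof.
move=> f0 mf.
rewrite (_ : (fun x => _) = (@powR R ^~ (-1)) \o (fine \o f)); last first.
  by apply/funext => x /=; rewrite powR_inv1// fine_ge0.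
by apply: measurableT_comp => //; exact: measurableT_comp.
Qed.

Lemma giry_bindE (d1 d2 : measure_display) (T1 : measurableType d1)
    (T2 : measurableType d2) (R : realType) (mu : giry T1 R)
    (f : T1 -> giry T2 R) (mf : measurable_fun [set: T1] f) (A : set T2) :
  measurable A -> giry_bind mu mf A = (\int[mu]_x f x A)%E.
Proof.
move=> mA; rewrite /giry_bind /= giry_int_map//.
exact: measurable_giry_ev.
Qed.

Lemma integral_giry_bind (d1 d2 : measure_display) (T1 : measurableType d1)
    (T2 : measurableType d2) (R : realType) (mu : giry T1 R)
    (f : T1 -> giry T2 R) (mf : measurable_fun [set: T1] f) (h : T2 -> \bar R) :
  measurable_fun [set: T2] h -> (forall x, 0 <= h x)%E ->
  (\int[giry_bind mu mf]_y h y = \int[mu]_x \int[f x]_y h y)%E.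
Proof. exact: giry_int_bind. Qed.

(** * Sub-Markov semigroups conditioned on survival *)

(** The law on the state space of a process that is killed at a random time:
    [kernel_at t x [set: E]] is the probability of being alive at time [t]. Full
    mass at time 0 excludes instantaneous killing, so that the law at time [t]
    given survival until [t] is [kernel_at t x] up to normalisation. *)
Record killed_semigroup (d : measure_display) (E : measurableType d)
    (R : realType) := {
  kernel_at :> R -> E -> giry E R ;
  measurable_kernel_at : forall t, measurable_fun setT (kernel_at t) ;
  kernel_at_add : forall s t x A, 0 <= s -> 0 <= t -> measurable A ->
    kernel_at (s + t) x A = (\int[kernel_at s x]_y kernel_at t y A)%E ;
  kernel_at_gt0 : forall t x, 0 <= t -> (0 < kernel_at t x [set: E])%E ;
  kernel_at0 : forall x, kernel_at 0 x [set: E] = 1%E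
}.

Section conditioned_kernels.
Context (d : measure_display) (E : measurableType d) (R : realType).
Variable S : killed_semigroup E R.
Local Open Scope ereal_scope.

Lemma measurable_kernel_fun t (A : set E) : measurable A ->
  measurable_fun [set: E] (fun x => S t x A).
Proof.
move=> mA; apply: (measurableT_comp (measurable_giry_ev mA)).
exact: measurable_kernel_at.
Qed.

Lemma measurable_integral_kernel t (f : E -> \bar R) :
  (forall x, 0 <= f x) -> measurable_fun setT f ->
  measurable_fun [set: E] (fun x => \int[S t x]_y f y).
Proof.
move=> f0 mf; apply: (measurableT_comp (measurable_giry_int mf f0)).
exact: measurable_kernel_at.
Qed.

Lemma integral_kernel_add s t x (f : E -> \bar R) :
  (0 <= s)%R -> (0 <= t)%R ->
  (forall x, 0 <= f x) -> measurable_fun setT f ->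
  \int[S (s + t)%R x]_y f y = \int[S s x]_y \int[S t y]_z f z.
Proof.
move=> s0 t0 f0 mf.
rewrite -(integral_giry_bind _ (measurable_kernel_at S t))//.
apply: eq_measure_integral => A mA _.
by apply: (etrans (kernel_at_add S x s0 t0 mA)); apply/esym; exact: giry_bindE.
Qed.

(* The measure [S v y E \d_y], obtained as the image of [S v y] under the constant
   map [y]; averaging it over [S u x (dy)] weights the position at time [u] by
   the probability of surviving [v] more units of time. *)
Let mark (v : R) (y : E) : giry E R := giry_map (measurable_cst y) (S v y).

Let measurable_mark v : measurable_fun setT (mark v).
Proof.
apply: measurable_giry_codensity => // B mB.
rewrite (_ : (fun x => _) = (fun y => S v y setT * (\1_B y)%:E)); last first.
  apply/funext => y; rewrite /mark /giry_map /= /pushforward preimage_cst indicE.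
  by case: ifPn => _; rewrite ?mule1 ?mule0 ?measure0.
apply: emeasurable_funM; first exact: measurable_kernel_fun.
exact/measurable_EFinP/measurable_indic.
Qed.

Definition survivors (u v : R) (x : E) : giry E R :=
  giry_bind (S u x) (measurable_mark v).

Lemma integral_survivors u v x (f : E -> \bar R) :
  (forall x, 0 <= f x) -> measurable_fun setT f ->
  \int[survivors u v x]_y f y = \int[S u x]_y (S v y setT * f y).
Proof.
move=> f0 mf; rewrite integral_giry_bind//; apply: eq_integral => y _.
rewrite [LHS]giry_int_map// muleC.
exact: (integral_cst (S v y) measurableT (f y)).
Qed.

Lemma survivorsE u v x (A : set E) : measurable A ->
  survivors u v x A = \int[S u x]_(y in A) S v y setT.
Proof.
move=> mA; rewrite -[A in LHS]setIT -[LHS]integral_indic//.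
rewrite integral_survivors//; last first.
  exact/measurable_EFinP/measurable_indic.
rewrite [RHS]integral_mkcond; apply: eq_integral => y _.
rewrite patchE indicE; case: ifPn; rewrite ?mule1 ?mule0//.
Qed.

Lemma survivors_setT u v x : (0 <= u)%R -> (0 <= v)%R ->
  survivors u v x setT = S (u + v)%R x setT.
Proof. by move=> u0 v0; rewrite survivorsE// kernel_at_add. Qed.

(** The law of the position at time [u] given survival until [u + v]. *)
Definition conditioned (u v : R) (x : E) : probability E R :=
  normalized (survivors u v x).

Lemma conditionedE u v x A : (0 <= u)%R -> (0 <= v)%R ->
  conditioned u v x A = (fine (S (u + v)%R x setT))^-1%:E * survivors u v x A.
Proof.
move=> u0 v0; rewrite normalizedE survivors_setT//.
by apply: kernel_at_gt0; rewrite addr_ge0.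
Qed.

Lemma measurable_conditioned u v A : (0 <= u)%R -> (0 <= v)%R -> measurable A ->
  measurable_fun setT (fun x => conditioned u v x A).
Proof.
move=> u0 v0 mA; under eq_fun do rewrite conditionedE// survivorsE// integral_mkcond.
apply: emeasurable_funM.
  apply/measurable_EFinP/measurable_inv_fine => //.
  exact: measurable_kernel_fun.
apply: measurable_integral_kernel; first by move=> y; apply: erestrict_ge0.
apply/(measurable_restrictT _ mA)/measurable_funTS; exact: measurable_kernel_fun.
Qed.

(** The normalising factor of [conditioned u' v y] is the survival probability
    [S (u' + v) y E], which is exactly the weight that [conditioned u (u' + v) x]
    puts on the position [y]. They cancel, and the semigroup property remains. *)
Lemma conditioned_add u u' v x A : (0 <= u)%R -> (0 <= u')%R -> (0 <= v)%R ->
  measurable A ->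
  conditioned (u + u')%R v x A =
  \int[conditioned u (u' + v)%R x]_y conditioned u' v y A.
Proof.
move=> u0 u'0 v0 mA.
have u'v0 : (0 <= u' + v)%R by rewrite addr_ge0.
rewrite integral_normalized//; last 2 first.
- by rewrite survivors_setT// kernel_at_gt0// addr_ge0.
- exact: measurable_conditioned.
rewrite survivors_setT// integral_survivors//; last exact: measurable_conditioned.
rewrite conditionedE ?addr_ge0// addrA; congr (_ * _).
rewrite survivorsE// integral_mkcond integral_kernel_add//; last 2 first.
- by move=> y; apply: erestrict_ge0.
- apply/(measurable_restrictT _ mA)/measurable_funTS; exact: measurable_kernel_fun.
apply: eq_integral => y _; rewrite -integral_mkcond -survivorsE// conditionedE//.
have Sfin : S (u' + v)%R y setT \is a fin_num by exact: fin_num_measure.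
rewrite -{1}(fineK Sfin) muleA -EFinM divff ?mul1e//.
by rewrite gt_eqF// fine_mass_gt0// kernel_at_gt0.
Qed.

End conditioned_kernels.

(** * Exponential loss of memory of the starting point *)

Section contraction.
Context (d : measure_display) (E : measurableType d) (R : realType).
Variable S : killed_semigroup E R.

(** Exchanging [x] and [y] shows that this one-sided bound is a bound on the
    absolute difference. *)
Definition osc_le (u v eps : R) : Prop := forall x y (A : set E),
  measurable A ->
  (conditioned S u v x A <= conditioned S u v y A + eps%:E)%E.

Lemma osc_le_mul u u' v del eps : 0 <= u -> 0 <= u' -> 0 <= v -> 0 <= del ->
  osc_le u (u' + v) del -> osc_le u' v eps -> osc_le (u + u') v (del * eps).
Proof.
move=> u0 u'0 v0 del0 osc_del osc_eps x y A mA.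
rewrite (conditioned_add S x u0 u'0 v0 mA) (conditioned_add S y u0 u'0 v0 mA).
have fE z : conditioned S u' v z A = (fine (conditioned S u' v z A))%:E.
  by rewrite fineK// fin_num_measure.
under eq_integral do rewrite fE.
under [X in (_ <= X + _)%E]eq_integral do rewrite fE.
apply: integral_le_osc => //.
- apply: measurableT_comp => //; exact: measurable_conditioned.
- move=> a b; have := osc_eps a b A mA.
  by rewrite fE [X in (_ <= X + _)%E]fE -EFinD lee_fin.
- by move=> B mB; exact: osc_del.
Qed.

Lemma osc_le1 u v : osc_le u v 1.
Proof.
move=> x y A mA; apply: (le_trans (probability_le1 _ mA)).
by rewrite leeDr.
Qed.

Variables u0 v0 : R.
Hypotheses (u0_gt0 : 0 < u0) (v0_ge0 : 0 <= v0).
Hypothesis osc_half : forall v, v0 <= v -> osc_le u0 v (2^-1).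

(** The remainder [r >= v0] guarantees that each of the [k] steps of length [u0]
    is taken with at least [v0] left before the horizon. *)
Lemma osc_le_expr k r : v0 <= r -> osc_le (k%:R * u0 + r) 0 (2^-1 ^+ k).
Proof.
move=> v0r; have r0 := le_trans v0_ge0 v0r.
elim: k => [|k ih]; first by rewrite mul0r add0r expr0; exact: osc_le1.
have ku0 : 0 <= k%:R * u0 by rewrite mulr_ge0// ltW.
rewrite exprS -natr1 mulrDl mul1r addrAC addrC.
apply: osc_le_mul => //; rewrite ?addr_ge0//; first exact: ltW.
by apply: osc_half; rewrite addr0 (le_trans v0r)// lerDr.
Qed.

(** Taking as many steps as fit before time [t - v0] leaves out less than
    [v0 + u0], whence the factor [exp(gamma (v0 + u0))]; it also makes the bound
    trivial for [t <= v0]. *)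
Lemma osc_le_exp : exists gamma C : R, [/\ 0 < gamma, 0 < C &
  forall t, 0 <= t -> osc_le t 0 (C * expR (- gamma * t))].
Proof.
have ln2 : 0 < ln 2 :> R by rewrite ln_gt0// ltr1n.
pose gamma := ln 2 / u0; have gamma0 : 0 < gamma by rewrite divr_gt0.
exists gamma, (expR (gamma * (v0 + u0))); split=> //; first exact: expR_gt0.
move=> t t0; rewrite -expRD.
have osc_leW (a b : R) : a <= b -> osc_le t 0 a -> osc_le t 0 b.
  move=> ab h x y A mA; apply: (le_trans (h x y A mA)).
  by rewrite leeD2l// lee_fin.
have [tv|vt] := leP t v0.
  apply: (osc_leW 1); last exact: osc_le1.
  rewrite -[leLHS]expR0 ler_expR mulNr -mulrBr mulr_ge0//; first exact: ltW.
  by move: u0_gt0 tv; lra.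
pose k := Num.truncn ((t - v0) / u0).
have q0 : 0 <= (t - v0) / u0 by rewrite divr_ge0 ?ltW// subr_gt0.
have /andP[] := truncn_itv q0; rewrite -/k.
rewrite ler_pdivlMr// ltr_pdivrMr// -natr1 => kq qk.
have h2 : 2^-1 = expR (- (gamma * u0)) :> R.
  by rewrite /gamma divfK ?gt_eqF// expRN lnK// posrE.
apply: (osc_leW (2^-1 ^+ k)); last first.
  have := @osc_le_expr k (t - k%:R * u0); rewrite subrKC; apply.
  by move: kq; lra.
rewrite h2 -expRM_natr ler_expR.
have /(mulr_ge0 (ltW gamma0)) : 0 <= (k%:R + 1) * u0 - (t - v0) by lra.
by lra.
Qed.

End contraction.

(** * The flow of conditional laws *)

Section conditioned_flow.
Context (d : measure_display) (E : measurableType d) (R : realType).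
Variable S : killed_semigroup E R.
Implicit Types mu nu : probability E R.
Local Open Scope ereal_scope.

Definition conditional_flow (t : R) mu : probability E R :=
  normalized (giry_bind (mu : giry E R) (measurable_kernel_at S t)).

Let mass t mu (A : set E) : measurable A ->
  giry_bind (mu : giry E R) (measurable_kernel_at S t) A = \int[mu]_x S t x A.
Proof. exact: giry_bindE. Qed.

Lemma integral_kernel_fin_num t mu (A : set E) : measurable A ->
  \int[mu]_x S t x A \is a fin_num.
Proof. by move=> mA; rewrite -mass// fin_num_measure. Qed.

Lemma integral_kernel_le1 t mu : \int[mu]_x S t x setT <= 1.
Proof. by rewrite -mass//; exact: sprobability_setT. Qed.

Lemma integral_kernel_gt0 t mu : (0 <= t)%R -> 0 < \int[mu]_x S t x setT.
Proof.
move=> t0; rewrite lt0e integral_ge0// andbT; apply/negP => /eqP int0.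
have : mu setT = 0.
  apply: (integral_eq0_measure0 measurableT _ _ int0).
    exact: measurable_kernel_fun.
  by move=> x _; exact: kernel_at_gt0.
by rewrite probability_setT => /eqP; rewrite onee_eq0.
Qed.

Lemma conditional_flow_mass t mu (A : set E) : (0 <= t)%R -> measurable A ->
  \int[mu]_x S t x setT * conditional_flow t mu A = \int[mu]_x S t x A.
Proof.
move=> t0 mA; rewrite -!mass//; apply: mass_normalized.
by rewrite mass// integral_kernel_gt0.
Qed.

(** The normalisation at time [s] is a constant that factors out: this is why
    conditioning on survival at successive times amounts to conditioning once, at
    the last time, although [conditional_flow] is not linear. *)
Lemma integral_conditional_flow s t mu (A : set E) : (0 <= s)%R -> (0 <= t)%R ->
  measurable A ->
  \int[mu]_x S s x setT * \int[conditional_flow s mu]_x S t x A =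
  \int[mu]_x S (s + t)%R x A.
Proof.
move=> s0 t0 mA; rewrite -mass// mass_integral_normalized//; last 2 first.
- by rewrite mass// integral_kernel_gt0.
- exact: measurable_kernel_fun.
rewrite integral_giry_bind//; last exact: measurable_kernel_fun.
by apply: eq_integral => x _; rewrite kernel_at_add.
Qed.

Lemma conditional_flow_add s t mu (A : set E) : (0 <= s)%R -> (0 <= t)%R ->
  measurable A ->
  conditional_flow (s + t) mu A = conditional_flow t (conditional_flow s mu) A.
Proof.
move=> s0 t0 mA; have st0 : (0 <= s + t)%R by rewrite addr_ge0.
apply: (@mule_cancel _ (\int[mu]_x S (s + t)%R x setT)).
- exact: integral_kernel_fin_num.
- exact: integral_kernel_gt0.
rewrite conditional_flow_mass// -!integral_conditional_flow// -muleA.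
by rewrite conditional_flow_mass.
Qed.

Lemma kernel_conditioned t x A : (0 <= t)%R -> measurable A ->
  S t x setT * conditioned S t 0 x A = S t x A.
Proof.
move=> t0 mA.
have -> : S t x setT = survivors S t 0 x setT by rewrite survivors_setT ?addr0.
rewrite mass_normalized; last by rewrite survivors_setT ?addr0// kernel_at_gt0.
rewrite survivorsE//; under eq_integral do rewrite kernel_at0.
by rewrite integral_cst// mul1e.
Qed.

(** Conditional laws started from [mu] and [nu] are averages of the laws
    [conditioned S t 0 x], with weights proportional to [S t x E mu(dx)] and
    [S t x E nu(dx)]. The weights differ, but since any two of the averaged laws
    are within [eps], so are any two averages. *)
Lemma conditional_flow_le t mu nu (eps : R) (A : set E) :
  (0 <= t)%R -> measurable A -> osc_le S t 0 eps ->
  conditional_flow t mu A <= conditional_flow t nu A + eps%:E.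
Proof.
move=> t0 mA osc.
have eps0 : (0 <= eps)%R.
  have := osc point point _ measurableT; rewrite !probability_setT -EFinD lee_fin.
  by lra.
have mS B : measurable B -> measurable_fun setT (fun x => S t x B).
  exact: measurable_kernel_fun.
have le_nu x : conditioned S t 0 x A <= conditional_flow t nu A + eps%:E.
  rewrite -(@lee_pmul2l _ (\int[nu]_y S t y setT)); last 2 first.
  - exact: integral_kernel_fin_num.
  - exact: integral_kernel_gt0.
  rewrite ge0_muleDr// ?lee_fin// conditional_flow_mass//.
  rewrite muleC [X in _ <= _ + X]muleC -!ge0_integralZl//; [|exact: mS..].
  rewrite -ge0_integralD//; [|exact: mS|by move=> y _; rewrite mule_ge0// lee_fin
    |by apply: measurable_funeM; exact: mS].
  apply: ge0_le_integral => //.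
  - by move=> y _; rewrite mule_ge0.
  - by apply: measurable_funeM; exact: mS.
  - apply: emeasurable_funD; first exact: mS.
    by apply: measurable_funeM; exact: mS.
  move=> y _; rewrite -(kernel_conditioned y t0 mA) ![_ * S _ _ _]muleC.
  by rewrite -ge0_muleDr ?lee_fin// lee_wpmul2l//; exact: osc.
rewrite -(@lee_pmul2l _ (\int[mu]_x S t x setT)); last 2 first.
- exact: integral_kernel_fin_num.
- exact: integral_kernel_gt0.
rewrite conditional_flow_mass// muleC -ge0_integralZl//; last 2 first.
- exact: mS.
- by rewrite adde_ge0.
apply: ge0_le_integral => //.
- exact: mS.
- by apply: measurable_funeM; exact: mS.
move=> x _; rewrite -(kernel_conditioned x t0 mA) muleC.
by rewrite lee_wpmul2r.
Qed.

End conditioned_flow.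

(** * Existence and uniqueness of the fixed point *)

Section ergodicity.
Context (d : measure_display) (E : measurableType d) (R : realType).
Variable S : killed_semigroup E R.
Variables gamma C : R.
Hypotheses (gamma_gt0 : 0 < gamma) (C_gt0 : 0 < C).
Hypothesis osc_exp : forall t, 0 <= t -> osc_le S t 0 (C * expR (- gamma * t)).

Let eps (n : nat) : R := C * expR (- gamma * n%:R).

Let eps_cvg0 : eps @ \oo --> (0 : R).
Proof.
rewrite -(mulr0 C); apply: cvgMr; rewrite /=.
rewrite (_ : (fun n => _) = (fun n => expR (- gamma) ^+ n)); last first.
  by apply/funext => n; rewrite -expRM_natr.
by apply: cvg_expr; rewrite ger0_norm ?expR_ge0// -[ltRHS]expR0 ltr_expR oppr_lt0.
Qed.

Let eq_of_le_eps (k x y : R) : (forall n, `|x - y| <= k * eps n) -> x = y.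
Proof.
move=> xy; apply/eqP; rewrite -subr_eq0 -normr_le0.
have keps : k * eps n @[n --> \oo] --> (0 : R).
  by rewrite -[X in _ --> X](mulr0 k); apply: cvgMr.
rewrite -(cvg_lim _ keps)//; apply: limr_ge; last exact: nearW.
by apply/cvg_ex; exists 0.
Qed.

Let flow_close n mu nu (A : set E) : measurable A ->
  `|fine (conditional_flow S n%:R mu A) - fine (conditional_flow S n%:R nu A)|
    <= eps n.
Proof.
move=> mA.
have := conditional_flow_le mu nu (ler0n R n) mA (osc_exp (ler0n R n)).
have := conditional_flow_le nu mu (ler0n R n) mA (osc_exp (ler0n R n)).
rewrite -[conditional_flow _ _ mu _]fineK ?fin_num_measure//.
rewrite -[conditional_flow _ _ nu _]fineK ?fin_num_measure//.
rewrite -!EFinD !lee_fin ler_norml -/(eps n) => ? ?.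
by apply/andP; split; lra.
Qed.

Lemma fixed_conditional_flow_unique (alpha beta : probability E R) :
  (forall t A, 0 <= t -> measurable A -> conditional_flow S t alpha A = alpha A) ->
  (forall t A, 0 <= t -> measurable A -> conditional_flow S t beta A = beta A) ->
  forall A : set E, measurable A -> beta A = alpha A.
Proof.
move=> fixa fixb A mA.
rewrite -[LHS]fineK ?fin_num_measure// -[RHS]fineK ?fin_num_measure//.
congr EFin; apply: (eq_of_le_eps (k := 1)) => n; rewrite mul1r.
by have := flow_close n beta alpha mA; rewrite fixa ?fixb.
Qed.

(** The orbit [a n] of a Dirac mass at integer times is Cauchy since [a (n + k)]
    and [a n] are two initial laws conditioned on survival for a time [n]. Its
    limit is fixed by the flow: [conditional_flow t] is a quotient of integrals
    of functions with values in [[0, 1]], hence continuous for uniform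
    convergence on events, and it maps [a n] to an [eps n]-close law, again
    because the flow may be run for [t] first and for [n] next. *)
Lemma stationary_conditional_flow : exists alpha : probability E R,
  forall t (A : set E), 0 <= t -> measurable A ->
    conditional_flow S t alpha A = alpha A.
Proof.
pose delta : probability E R := \d_point.
have [n m A nm mA|alpha alphaE] := setwise_limit
    (mu := fun n => conditional_flow S n%:R delta) eps_cvg0.
  rewrite -(subnK nm) natrD conditional_flow_add ?ler0n//.
  exact: flow_close.
exists alpha => t A t0 mA; pose a n := conditional_flow S n%:R delta.
have eps0 n : 0 <= eps n by rewrite mulr_ge0 ?expR_ge0// ltW.
have int_close n (B : set E) : measurable B ->
    `|fine (\int[alpha]_x S t x B) - fine (\int[a n]_x S t x B)| <= eps n.
  move=> mB.
  have SE x : S t x B = (fine (S t x B))%:E by rewrite fineK// fin_num_measure.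
  have int_le (mu nu : probability E R) :
      (forall D, measurable D -> (mu D <= nu D + (eps n)%:E)%E) ->
      fine (\int[mu]_x S t x B) <= fine (\int[nu]_x S t x B) + eps n.
    move=> munu; rewrite -lee_fin EFinD !fineK ?integral_kernel_fin_num//.
    under eq_integral do rewrite SE.
    under [X in (_ <= X + _)%E]eq_integral do rewrite SE.
    rewrite -[eps n]mulr1; apply: integral_le_osc => //.
    - by apply: measurableT_comp => //; exact: measurable_kernel_fun.
    - move=> x y; have y0 : 0 <= fine (S t y B) by exact: fine_ge0.
      suff : fine (S t x B) <= 1 by move: y0; lra.
      rewrite -lee_fin -SE (le_trans _ (sprobability_setT (s := S t x)))//.
      by apply: le_measure; rewrite ?inE.
  have al_le D : measurable D -> (alpha D <= a n D + (eps n)%:E)%E.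
    move=> mD; have := alphaE n D mD.
    rewrite -[alpha D]fineK ?fin_num_measure// -[a n D]fineK ?fin_num_measure//.
    by rewrite -EFinD lee_fin ler_norml -/(a n) => /andP[? ?]; lra.
  have le_al D : measurable D -> (a n D <= alpha D + (eps n)%:E)%E.
    move=> mD; have := alphaE n D mD.
    rewrite -[alpha D]fineK ?fin_num_measure// -[a n D]fineK ?fin_num_measure//.
    by rewrite -EFinD lee_fin ler_norml -/(a n) => /andP[? ?]; lra.
  have := int_le _ _ al_le; have := int_le _ _ le_al => ? ?.
  by rewrite ler_norml; apply/andP; split; lra.
have fin1 (mu : probability E R) (D : set E) : measurable D ->
    0 <= fine (mu D) <= 1.
  move=> mD; rewrite fine_ge0//= -lee_fin fineK ?fin_num_measure//.
  exact: probability_le1.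
pose IE := fine (\int[alpha]_x S t x setT); pose IA := fine (\int[alpha]_x S t x A).
have le_eps n : `|IA - IE * fine (alpha A)| <= 4 * eps n.
  have := int_close n _ mA; have := int_close n _ measurableT.
  have : `|fine (conditional_flow S t (a n) A) - fine (a n A)| <= eps n.
    rewrite -conditional_flow_add ?ler0n// (addrC _ t) conditional_flow_add ?ler0n//.
    exact: flow_close.
  have := alphaE n A mA.
  have := congr1 fine (conditional_flow_mass S (a n) t0 mA).
  rewrite fineM ?fin_num_measure ?integral_kernel_fin_num//.
  have /andP[] := fin1 alpha A mA.
  have : 0 <= fine (\int[a n]_x S t x setT) <= 1.
    rewrite fine_ge0//= ?integral_ge0// -lee_fin fineK ?integral_kernel_fin_num//.
    exact: integral_kernel_le1.
  rewrite -/IA -/IE -/(a n).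
  move: (fine (alpha A)) (fine (a n A)) (fine (conditional_flow S t (a n) A)).
  move: (fine (\int[a n]_x S t x setT)) (fine (\int[a n]_x S t x A)).
  move=> En An al an bn /andP[En0 En1] al0 al1 <- al_an bn_an IE_En IA_An.
  have -> : IA - IE * al = (IA - En * bn) + En * (bn - al) - (IE - En) * al by ring.
  rewrite (le_trans (ler_normB _ _))// (le_trans (lerD (ler_normD _ _) (lexx _)))//.
  have -> : 4 * eps n = eps n + (eps n + eps n) + eps n by ring.
  apply: lerD; first apply: lerD => //.
    rewrite normrM ger0_norm// -[leRHS]mul1r ler_pM//.
    rewrite -[bn - al](subrKA an) (le_trans (ler_normD _ _))// lerD//.
    by rewrite distrC.
  by rewrite normrM (ger0_norm al0) -[leRHS]mulr1 ler_pM.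
have I_eq : IA = IE * fine (alpha A) by exact: eq_of_le_eps le_eps.
apply: (@mule_cancel _ (\int[alpha]_x S t x setT)).
- exact: integral_kernel_fin_num.
- exact: integral_kernel_gt0.
rewrite conditional_flow_mass// -[LHS]fineK ?integral_kernel_fin_num//.
rewrite -/IA I_eq EFinM fineK ?integral_kernel_fin_num//.
by rewrite fineK// fin_num_measure.
Qed.

End ergodicity.

(** * The semigroup of an absorbed Markov process *)

Section absorbed_process.
Context (R : realType) (d : measure_display) (E : measurableType d)
  (d' : measure_display) (Om : measurableType d').
Variable X : absorbed_markov_process R E Om.
Local Open Scope ereal_scope.

Definition alive_in (t : R) (A : set E) : set Om :=
  mp_pos X t @^-1` (Some @` A).

Local Notation P x := (mp_law X (Some x)).

Lemma adapted_alive_in t A : (0 <= t)%R -> measurable A ->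
  mp_filtration X t (alive_in t A).
Proof. by move=> t0 mA; apply: mp_adapted => //; exact: measurable_image_Some. Qed.

Lemma measurable_alive_in t A : measurable A -> measurable (alive_in t A).
Proof.
by move=> mA; apply: (measurable_funPTI (mp_pos X t)); exact: measurable_image_Some.
Qed.

Lemma subset_alive_in t A : alive_in t A `<=` alive_in t setT.
Proof. by move=> w [y _ yw]; exists y. Qed.

Lemma survival_alive_in t T : (0 <= t)%R -> (t <= T)%R ->
  survival X T `<=` alive_in t setT.
Proof.
move=> t0 tT w; rewrite /survival/= /alive_in/=.
case Xt : (mp_pos X t w) => [y|] Ttau; first by exists y.
have : tau X w <= t%:E by apply: ereal_inf_lbound; exists t.
by rewrite leNgt (le_lt_trans _ Ttau)// lee_fin.
Qed.

Lemma filtration_setI t (A B : set Om) : (0 <= t)%R ->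
  mp_filtration X t A -> mp_filtration X t B -> mp_filtration X t (A `&` B).
Proof.
move=> t0; have FX := mp_filtration_sigma_algebra X t0.
have [_ _ _] := (sigma_algebraP (fun A _ => @subsetT _ A)).1 FX.
exact.
Qed.

(** As the lifetime is a stopping time, the event [D] of being in [E] at time [T]
    without surviving beyond [T] belongs to the past of [T]. On [D] the process
    is almost surely absorbed at time [T + 1], whereas by the Markov property it
    is alive then with positive conditional probability. So [D] is null. *)
Lemma alive_not_surviving_negligible x T : (0 <= T)%R ->
  P x (alive_in T setT `\` survival X T) = 0.
Proof.
move=> T0; set D := _ `\` _.
have T1 : (0 <= T + 1)%R by rewrite addr_ge0.
have mD : measurable D.
  by apply: measurableD; [exact: measurable_alive_in|exact: measurable_survival].
have FD : mp_filtration X T D.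
  rewrite (_ : D = alive_in T setT `&` [set w | tau X w <= T%:E]).
    by apply: filtration_setI => //; [exact: adapted_alive_in|exact: amp_stopping_time].
  by apply/seteqP; split => w [aw] /=; rewrite leNgt => /negP.
have dead : P x (D `&` alive_in (T + 1) setT) = 0.
  apply: measure_negligible.
    by apply: measurableI => //; exact: measurable_alive_in.
  apply: negligibleS (amp_absorbing X x) => w [[_ wT] [y _ yw]] /= abs; apply: wT.
  rewrite /survival/= (@lt_le_trans _ _ (T + 1)%:E) ?lte_fin ?ltrDl//.
  apply: le_ereal_inf_tmp => _ [s [s0 Xs] <-]; rewrite lee_fin leNgt.
  apply/negP => /ltW sT; have := abs s (T + 1)%R s0 sT Xs.
  by rewrite -yw.
have mSome : measurable (Some @` [set: E]) by exact: measurable_image_Some.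
move: dead; rewrite mp_markov//.
apply: integral_eq0_measure0 => //.
  apply: measurable_funTS; apply: (measurableT_comp (f := fun z => mp_law X z _)) => //.
  by apply: mp_law_measurable; exact: measurable_alive_in.
move=> w [[y _ yw] _]; rewrite -yw.
apply: (lt_le_trans (amp_survival X y ler01)).
apply: le_measure; rewrite ?inE.
- exact: measurable_survival.
- exact: measurable_alive_in.
- exact: survival_alive_in.
Qed.

Lemma law_setI_survival x T F : (0 <= T)%R -> measurable F ->
  P x (F `&` survival X T) = P x (F `&` alive_in T setT).
Proof.
move=> T0 mF; have mS := measurable_survival X T.
have mA := measurable_alive_in T measurableT.
rewrite (measureDI (P x) (measurableI _ _ mF mA) mS).
rewrite [X in _ = X + _](_ : _ = 0) ?add0e.
  rewrite -setIA; congr (P x (F `&` _)); apply/esym/setIidr.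
  exact: survival_alive_in.
apply: (subset_measure0 (B := alive_in T setT `\` survival X T)).
- by apply: measurableD => //; exact: measurableI.
- exact: measurableD.
- by move=> w [[_ ?] ?].
- exact: alive_not_surviving_negligible.
Qed.

(* the law on [E] of a position in [option E], with no mass when absorbed *)
Let point_mass (z : option E) : giry E R :=
  if z is Some y then (\d_y : probability E R) else mzero.

Let point_massE z A : measurable A -> point_mass z A = (\1_(Some @` A) z)%:E.
Proof.
move=> mA; case: z => [y|] /=; rewrite indicE; last first.
  by rewrite memNset// => -[].
rewrite [LHS]diracE; suff -> : (Some y \in Some @` A) = (y \in A) by [].
apply/idP/idP; rewrite !inE; first by move=> [z Az [<-]].
by move=> Ay; exists y.
Qed.

Let measurable_point_mass t :
  measurable_fun setT (fun w => point_mass (mp_pos X t w)).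
Proof.
apply: (measurableT_comp (f := point_mass)) => //.
apply: measurable_giry_codensity => // A mA.
under eq_fun do rewrite point_massE//.
by apply/measurable_EFinP/measurable_indic; exact: measurable_image_Some.
Qed.

(** A mixture of point masses rather than the set function
    [A |-> P_x(X_t \in A)], so that integrals against it are integrals over the
    probability space by [integral_giry_bind]. *)
Definition alive_kernel (t : R) (x : E) : giry E R :=
  giry_bind (P x : giry Om R) (measurable_point_mass t).

Lemma alive_kernelE t x A : measurable A ->
  alive_kernel t x A = P x (alive_in t A).
Proof.
move=> mA; rewrite [LHS]giry_bindE//.
under eq_integral do rewrite point_massE//.
transitivity (\int[P x]_w (\1_(alive_in t A) w)%:E).
  by apply: eq_integral => w _; rewrite !indicE.
by rewrite integral_indic ?setIT//; exact: measurable_alive_in.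
Qed.

Lemma integral_alive_kernel t x A (f : option E -> \bar R) :
  (forall z, 0 <= f z) -> measurable_fun setT f -> measurable A ->
  \int[alive_kernel t x]_(y in A) f (Some y) =
  \int[P x]_(w in alive_in t A) f (mp_pos X t w).
Proof.
move=> f0 mf mA.
have mfS : measurable_fun setT (fun y : E => f (Some y)).
  exact: measurableT_comp mf (@measurable_Some _ _).
rewrite integral_mkcond integral_giry_bind//; last 2 first.
- by apply/(measurable_restrictT _ mA)/measurable_funTS.
- by move=> y; apply: erestrict_ge0.
rewrite [RHS]integral_mkcond; apply: eq_integral => w _.
rewrite [RHS]patchE; have [/set_mem[y Ay yw]|wA] := boolP (w \in alive_in t A).
  rewrite -yw /= integral_dirac//.
    by rewrite diracT mul1e patchE mem_set.
  by apply/(measurable_restrictT _ mA)/measurable_funTS.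
case Xt : (mp_pos X t w) => [y|] /=; last by rewrite integral_measure_zero.
rewrite integral_dirac//; last by apply/(measurable_restrictT _ mA)/measurable_funTS.
rewrite patchE memNset ?mule0// => Ay; move/negP: wA; apply.
by apply/mem_set; exists y.
Qed.

Lemma law_alive_in_add s t x A B : (0 <= s)%R -> (0 <= t)%R ->
  measurable A -> measurable B ->
  P x (alive_in s A `&` alive_in (s + t) B) =
  \int[alive_kernel s x]_(y in A) alive_kernel t y B.
Proof.
move=> s0 t0 mA mB.
rewrite mp_markov//; last 2 first.
- exact: measurable_image_Some.
- exact: adapted_alive_in.
pose f z := mp_law X z (alive_in t B).
rewrite -(integral_alive_kernel s x (f := f))//; last first.
  by apply: mp_law_measurable; exact: measurable_alive_in.
by apply: eq_integral => y _; rewrite /f alive_kernelE.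
Qed.

(** Being alive at time [s + t] almost surely entails being alive at time [s],
    because it almost surely entails surviving beyond [s + t]; so the Markov
    property may be applied on the event of being alive at time [s], where the
    position is a point of [E]. *)
Lemma alive_kernel_add s t x A : (0 <= s)%R -> (0 <= t)%R -> measurable A ->
  alive_kernel (s + t) x A = \int[alive_kernel s x]_y alive_kernel t y A.
Proof.
move=> s0 t0 mA; have st0 : (0 <= s + t)%R by rewrite addr_ge0.
have mal r B := @measurable_alive_in r B.
rewrite -law_alive_in_add// alive_kernelE//.
rewrite -[X in P x X](setIidl (@subset_alive_in _ A)) -law_setI_survival//;
  last exact: mal.
rewrite -[in RHS](setIidl (@subset_alive_in _ A)) setIA -law_setI_survival//;
  last by apply: measurableI; exact: mal.
congr (P x _); apply/seteqP; split => [w [wA wS]|w [[_ wA] wS]]; split => //.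
split => //; apply: survival_alive_in wS => //.
by rewrite lerDl.
Qed.

Lemma law_survival t x : (0 <= t)%R ->
  P x (survival X t) = alive_kernel t x setT.
Proof.
by move=> t0; rewrite alive_kernelE// -[survival X t]setTI law_setI_survival// setTI.
Qed.

Lemma measurable_alive_kernel t : measurable_fun setT (alive_kernel t).
Proof.
apply: measurable_giry_codensity => // A mA.
under eq_fun do rewrite alive_kernelE//.
have mlaw := mp_law_measurable X (measurable_alive_in t mA).
exact: measurableT_comp mlaw (@measurable_Some _ E).
Qed.

Lemma alive_kernel_gt0 t x : (0 <= t)%R -> 0 < alive_kernel t x setT.
Proof. by move=> t0; rewrite -law_survival// amp_survival. Qed.

Lemma alive_kernel0 x : alive_kernel 0 x setT = 1.
Proof.
rewrite alive_kernelE// mp_law_initial; last exact: measurable_image_Some.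
by rewrite diracE mem_set//; exists x.
Qed.

Definition alive_semigroup : killed_semigroup E R :=
  {| kernel_at := alive_kernel;
     measurable_kernel_at := measurable_alive_kernel;
     kernel_at_add := alive_kernel_add;
     kernel_at_gt0 := alive_kernel_gt0;
     kernel_at0 := alive_kernel0 |}.

Lemma cond_law_conditioned u v x A : (0 <= u)%R -> (0 <= v)%R -> measurable A ->
  cond_law X (P x) u (u + v) A = conditioned alive_semigroup u v x A.
Proof.
move=> u0 v0 mA; have uv0 : (0 <= u + v)%R by rewrite addr_ge0.
rewrite conditionedE// /cond_law muleC; congr (_ * _).
  by rewrite -law_survival.
rewrite survivorsE// law_setI_survival ?law_alive_in_add//.
exact: measurable_alive_in.
Qed.

Lemma cond_law_conditional_flow t mu A : (0 <= t)%R -> measurable A ->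
  cond_law X (law_from X mu) t t A = conditional_flow alive_semigroup t mu A.
Proof.
move=> t0 mA.
have int_law B : measurable B -> law_from X mu (alive_in t B `&` survival X t) =
    \int[mu]_x alive_semigroup t x B.
  move=> mB; apply: eq_integral => x _.
  rewrite law_setI_survival//; last exact: measurable_alive_in.
  by rewrite (setIidl (@subset_alive_in _ _)) -alive_kernelE.
have survE : law_from X mu (survival X t) = \int[mu]_x alive_semigroup t x setT.
  rewrite -int_law//; congr (law_from X mu _); apply/esym/setIidr.
  exact: survival_alive_in.
have Mfin := integral_kernel_fin_num alive_semigroup t mu measurableT.
have M0 := integral_kernel_gt0 alive_semigroup mu t0.
apply: (mule_cancel Mfin M0).
rewrite conditional_flow_mass// -(int_law A)// /cond_law [X in fine X]survE muleCA.
rewrite -{1}(fineK Mfin) -EFinM divff ?mule1// gt_eqF// fine_gt0// M0/=.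
by rewrite ltey_eq Mfin.
Qed.

End absorbed_process.

(** * Quasi-stationary distributions *)

Theorem theorem2p4 (R : realType) (d : measure_display) (E : measurableType d)
    (d1 : measure_display) (Om : measurableType d1)
    (X : absorbed_markov_process R E Om)
    (hQ : exists (d2 : measure_display) (Om' : measurableType d2)
                 (Q : markov_process R E Om'),
      (forall t : R, 0 < t ->
        ereal_sup (range (fun x : E =>
          tv_dist (distribution (mp_law Q x) (mp_pos Q t))
                  (cond_law X (mp_law X (Some x)) t T)))
        @[T --> +oo] --> 0%E)
      /\
      (ereal_sup (range (fun xy : E * E =>
          tv_dist (distribution (mp_law Q xy.1) (mp_pos Q t))
                  (distribution (mp_law Q xy.2) (mp_pos Q t))))
        @[t --> +oo] --> 0%E)) :
  exists alpha : probability E R,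
    [/\ quasi_stationary X alpha,
        (forall beta : probability E R, quasi_stationary X beta ->
           forall A : set E, measurable A -> beta A = alpha A)
      & exists gamma C : R, [/\ 0 < gamma, 0 < C &
          forall (mu : probability E R) (t : R), 0 <= t ->
            (tv_dist (cond_law X (law_from X mu) t t) alpha
              <= (C * expR (- gamma * t))%:E)%E]].
Proof.
have [d2 [Om' [Q [Q_close Q_mix]]]] := hQ.
(* The laws of the conditioned process and of [Q] are compared twice and those
   of [Q] once, so three errors of 1/6 make up the 1/2 of [osc_le_exp]. *)
have lt6 : (0 < (6^-1 : R)%:E)%E by rewrite lte_fin invr_gt0.
have near6 (f : R -> \bar R) : f @ +oo --> 0%E ->
    exists2 a : R, 0 < a & forall t, a <= t -> (f t <= (6^-1)%:E)%E.
  move=> /(_ _ (open_ereal_lt' lt6)) [M [_ fM]].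
  exists (Num.max 0 M + 1).
    by rewrite ltr_pwDr// le_max lexx.
  move=> t Mt; apply/ltW/fM; apply: lt_le_trans Mt.
  by rewrite ltr_pwDr// le_max lexx orbT.
have [u0 u0_gt0 /(_ u0 (lexx _)) mix] := near6 _ Q_mix.
have [T0 T0_gt0 close] := near6 _ (Q_close u0 u0_gt0).
pose S := alive_semigroup X.
have osc_half v : T0 <= v -> osc_le S u0 v 2^-1.
  move=> T0v x y A mA.
  have v0 := le_trans (ltW T0_gt0) T0v.
  rewrite -!cond_law_conditioned ?(ltW u0_gt0)//.
  have {}close z := le_trans (ereal_sup_ubound (imageT _ z)) (close (u0 + v) _).
  have T0uv : T0 <= u0 + v by rewrite (le_trans T0v)// lerDr ltW.
  have Kx := le_add_tv_distr (distribution (mp_law Q x) (mp_pos Q u0))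
    (cond_law X (mp_law X (Some x)) u0 (u0 + v)) mA.
  have Qxy := le_add_tv_dist (distribution (mp_law Q x) (mp_pos Q u0))
    (distribution (mp_law Q y) (mp_pos Q u0)) mA.
  have Ky := le_add_tv_dist (distribution (mp_law Q y) (mp_pos Q u0))
    (cond_law X (mp_law X (Some y)) u0 (u0 + v)) mA.
  have {}mix := le_trans (ereal_sup_ubound (imageT _ (x, y))) mix.
  have -> : 2^-1 = 6^-1 + 6^-1 + 6^-1 :> R by lra.
  rewrite !EFinD !addeA.
  apply: (le_trans Kx); apply: leeD; last exact: close.
  apply: (le_trans Qxy); apply: leeD; last exact: mix.
  by apply: (le_trans Ky); apply: leeD => //; exact: close.
have [gamma [C [gamma0 C0 osc_exp]]] := osc_le_exp u0_gt0 (ltW T0_gt0) osc_half.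
have [alpha alphaP] := stationary_conditional_flow gamma0 C0 osc_exp.
have flow_le mu nu t A : 0 <= t -> measurable A ->
    (conditional_flow S t mu A <=
     conditional_flow S t nu A + (C * expR (- gamma * t))%:E)%E.
  by move=> t0 mA; apply: conditional_flow_le => //; exact: osc_exp.
exists alpha; split.
- by move=> t t0 A mA; rewrite cond_law_conditional_flow// alphaP.
- move=> beta qbeta; apply: (fixed_conditional_flow_unique gamma0 osc_exp alphaP).
  by move=> t A t0 mA; rewrite -cond_law_conditional_flow// qbeta.
(* a bound [c] on every event costs a factor 2 in total variation norm *)
exists gamma, (C + C); split=> //; first exact: addr_gt0.
move=> mu t t0; rewrite mulrDl; apply: tv_dist_le => A mA.
  have := flow_le mu alpha t A t0 mA.
  by rewrite alphaP// -cond_law_conditional_flow.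
have := flow_le alpha mu t A t0 mA.
by rewrite alphaP// -cond_law_conditional_flow.
Qed.
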